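(* Let $\Gamma=(\mathcal{S},\mathcal{A},P,r,\gamma)$ be a stationary mean field game with strategic complementarities. Then there exists a trembling-hand-perfect mean field equilibrium (T-MFE) for $\Gamma$, i.e. there exist a trembling-hand strategy $\mu^*\in\Pi^{\epsilon}$ and a mean field $z^*\in\mathcal{P}(\mathcal{S})$ such that $\mu^*\in\Psi(z^* )$ and $z^*=\Phi(z^*,\mu^* )$.
   Context: Model. A stationary mean field game $\Gamma=(\mathcal{S},\mathcal{A},P,r,\gamma)$ consists of a finite state space $\mathcal{S}$, a finite action space $\mathcal{A}$ ($|\mathcal{A}|\ge 2$), a transition kernel $P(\cdot\mid s,a,z)\in\mathcal{P}(\mathcal{S})$ and a reward $r(s,a,z)\in\mathbb{R}$ with $|r(s,a,z)|\le 1$, for $s\in\mathcal{S}$, $a\in\mathcal{A}$ and mean field $z\in\mathcal{P}(\mathcal{S})$, and a discount factor $\gamma\in(0,1)$; $\mathcal{P}(X)$ is the set of probability distributions on $X$. A strategy is a map $\mu:\mathcal{S}\to\mathcal{P}(\mathcal{A})$, written $\mu(s,a)$. The McKean-Vlasov map is $\Phi(z,\mu)(s')=\sum_{s\in\mathcal{S}}\sum_{a\in\mathcal{A}}z(s)\mu(s,a)P(s'\mid s,a,z)$. For a fixed mean field $z$, $V_{\mu,z}(s)=\mathbb{E}[\sum_{t\ge0}\gamma^t r(s_t,a_t,z)\mid s_0=s]$ with $a_t\sim\mu(s_t,\cdot)$, $s_{t+1}\sim P(\cdot\mid s_t,a_t,z)$. Trembling-hand strategies. Fix $\epsilon\in(0,1)$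 with $1-\epsilon>\epsilon/(|\mathcal{A}|-1)$. $\Pi^\epsilon$ is the set of strategies $\mu$ such that for each $s$ there is an action $a_s$ with $\mu(s,a_s)=1-\epsilon$ and $\mu(s,a)=\epsilon/(|\mathcal{A}|-1)$ for all $a\ne a_s$. $V^*_z=\max_{\mu\in\Pi^\epsilon}V_{\mu,z}$ (maximum at every state) and $\Psi(z)=\arg\max_{\mu\in\Pi^\epsilon}V_{\mu,z}$ is the set of $\mu\in\Pi^\epsilon$ attaining it. Strategic complementarities. $\mathcal{S}$ and $\mathcal{A}$ are lattices, $\mathcal{S}\times\mathcal{A}$ has the product order. For distributions $p,p'$ on an ordered set $X$, $p\succeq_{SD}p'$ means $\sum_x f(x)p(x)\ge\sum_x f(x)p'(x)$ for every bounded non-decreasing $f$; mean fields are ordered by $\succeq_{SD}$. A real function $f$ on a lattice is supermodular if $f(\sup\{x,x'\})+f(\inf\{x,x'\})\ge f(x)+f(x')$; $f(x,y)$ has increasing differences in $x$ and $y$ if $f(x',y')-f(x',y)\ge f(x,y')-f(x,y)$ for $x'\succeq x$, $y'\succeq y$. A kernel $p(\cdot\mid y)$ is stochastically non-decreasing (resp. stochastically supermodular, resp. has stochastically increasing differences) if $\sum_x f(x)p(x\mid\cdot)$ is non-decreasing (resp. supermodular, resp. has increasing differences) in the indicated arguments for every bounded non-decreasing $f$. $\Gamma$ is a mean field game with strategic complementarities if: (i) $r(s,a,z)$ is non-decreasing in $s$, supermodular in $(s,a)$, has increasing differences in $(s,a)$ and $z$, and $\max_a r(s,a,z)$ is non-decreasing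 in $s$ for each fixed $z$; (ii) $P(\cdot\mid s,a,z)$ is stochastically supermodular in $(s,a)$, has stochastically increasing differences in $(s,a)$ and $z$, and is stochastically non-decreasing in each of $s$, $a$, $z$. *)

(* Defs.v *)
From HB Require Import structures.
From mathcomp Require Import all_boot all_order all_algebra.
From mathcomp Require Import all_classical all_reals all_analysis.
From mathcomp Require Import lra ring.

Set Implicit Arguments.
Unset Strict Implicit.
Unset Printing Implicit Defensive.

Import Order.TTheory GRing.Theory Num.Theory.
Import numFieldNormedType.Exports.

Local Open Scope classical_set_scope.
Local Open Scope ring_scope.

Record dist (R : realType) (X : finType) := Dist {
  dist_val :> {ffun X -> R};
  distP : [forall x, 0 <= dist_val x] && (\sum_x dist_val x == 1)
}.

HB.instance Definition _ (R : realType) (X : finType) :=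
  [isSub for @dist_val R X].
HB.instance Definition _ (R : realType) (X : finType) :=
  [Choice of dist R X by <:].

Section DistTheory.
Variables (R : realType) (X : finType).
Implicit Type p : dist R X.

Lemma dist_ge0 p x : 0 <= p x.
Proof. by have /andP[/forallP/(_ x)] := distP p. Qed.

Lemma dist_sum p : \sum_x p x = 1.
Proof. by have /andP[_ /eqP] := distP p. Qed.

End DistTheory.

Section Orders.
Variable R : realType.

(* On a finite set every function is bounded, so the boundedness of the test
   functions f below is automatic. *)
Definition sd_le d (X : finPOrderType d) (p p' : dist R X) : Prop :=
  forall f : X -> R, {homo f : x y / (x <= y)%O >-> x <= y} ->
    \sum_x f x * p x <= \sum_x f x * p' x.

Definition supermodular d (L : latticeType d) (f : L -> R) : Prop :=
  forall x x' : L,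
    f x + f x' <= f (Order.join x x') + f (Order.meet x x').

Definition increasing_differences (X Y : Type) (leX : X -> X -> Prop)
    (leY : Y -> Y -> Prop) (f : X -> Y -> R) : Prop :=
  forall x x' y y', leX x x' -> leY y y' ->
    f x y' - f x y <= f x' y' - f x' y.

Definition nondecreasing_for (X : Type) (leX : X -> X -> Prop) (f : X -> R)
    : Prop :=
  forall x x', leX x x' -> f x <= f x'.

Section Kernels.
Context d (X : finPOrderType d).

Definition stoch_supermodular d' (L : latticeType d') (p : L -> dist R X)
    : Prop :=
  forall f : X -> R, {homo f : x y / (x <= y)%O >-> x <= y} ->
    supermodular (fun y => \sum_x f x * p y x).

Definition stoch_increasing_differences (Y Z : Type) (leY : Y -> Y -> Prop)
    (leZ : Z -> Z -> Prop) (p : Y -> Z -> dist R X) : Prop :=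
  forall f : X -> R, {homo f : x y / (x <= y)%O >-> x <= y} ->
    increasing_differences leY leZ (fun y z => \sum_x f x * p y z x).

Definition stoch_nondecreasing (Y : Type) (leY : Y -> Y -> Prop)
    (p : Y -> dist R X) : Prop :=
  forall f : X -> R, {homo f : x y / (x <= y)%O >-> x <= y} ->
    nondecreasing_for leY (fun y => \sum_x f x * p y x).

End Kernels.

End Orders.

(* Existence of a Markov chain on [0, 1] with Lebesgue measure: the history
   x_n, ..., x_0 (latest state first) corresponds to the interval
   [lo h, lo h + wt h[, which is cut into the intervals of its one-step
   extensions. *)
Section MarkovChain.
Variables (R : realType) (T : finType) (t0 : T) (q0 : T -> R) (K : T -> T -> R).
Hypotheses (q0_ge0 : forall x, 0 <= q0 x) (q0_sum : \sum_x q0 x = 1).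
Hypotheses (K_ge0 : forall x y, 0 <= K x y) (K_sum : forall x, \sum_y K x y = 1).

Let step (h : seq T) x := if h is y :: _ then K y x else q0 x.
Let wt := fix wt (h : seq T) : R := if h is x :: h' then wt h' * step h' x else 1.
Let cum (h : seq T) k := \sum_(y | (enum_rank y < k)%N) step h y.
Let lo := fix lo (h : seq T) : R :=
  if h is x :: h' then lo h' + wt h' * cum h' (enum_rank x) else 0.
Let I h : set R := [set w | lo h <= w < lo h + wt h].
Let H := fix H n (w : R) : seq T := if n is m.+1 then
  odflt t0 [pick x | `[< I (x :: H m w) w >]] :: H m w else [::].

Let step_ge0 h x : 0 <= step h x.
Proof. by case: h => /=. Qed.

Let step_sum h : \sum_x step h x = 1.
Proof. by case: h => /=. Qed.

Let wt_ge0 h : 0 <= wt h.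
Proof. by elim: h => //= x h IH; rewrite mulr_ge0. Qed.

Let cumS h x : cum h (enum_rank x).+1 = cum h (enum_rank x) + step h x.
Proof.
rewrite /cum (bigD1 x) //= addrC; congr (_ + _); apply: eq_bigl => y.
by rewrite ltnS ltn_neqAle (inj_eq val_inj) (inj_eq enum_rank_inj) andbC.
Qed.

Let cum_le h k l : (k <= l)%N -> cum h k <= cum h l.
Proof.
move=> kl; rewrite /cum [leRHS]big_mkcond [leLHS]big_mkcond ler_sum // => y _.
by case: ifPn => [/leq_trans/(_ kl) ->//|_]; case: ifP.
Qed.

Let cum0 h : cum h 0 = 0.
Proof. by rewrite /cum big_pred0. Qed.

Let cumT h : cum h #|T| = 1.
Proof. by rewrite -(step_sum h); apply: eq_bigl => y; rewrite ltn_ord. Qed.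

Let IE x h w : I (x :: h) w <->
  lo h + wt h * cum h (enum_rank x) <= w < lo h + wt h * cum h (enum_rank x).+1.
Proof. by rewrite /I /= cumS mulrDr addrA. Qed.

Let I_sub x h w : I (x :: h) w -> I h w.
Proof.
move=> /IE/andP[h1 h2]; rewrite /I /=; apply/andP; split.
  by apply: le_trans h1; rewrite lerDl mulr_ge0 // -(cum0 h) cum_le.
apply: (lt_le_trans h2); rewrite lerD2l -[leRHS]mulr1 ler_wpM2l //.
by rewrite -(cumT h) cum_le.
Qed.

Let I_disj x y h w : I (x :: h) w -> I (y :: h) w -> x = y.
Proof.
wlog xy : x y / (enum_rank x <= enum_rank y)%N.
  by move=> W hx hy; case: (leqP (enum_rank x) (enum_rank y)) => [/W|/ltnW/W] ->.
move=> /IE/andP[_ h2] /IE/andP[h3 _]; apply: enum_rank_inj; apply: val_inj.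
apply/eqP; rewrite eqn_leq xy /= leqNgt; apply/negP => lt.
have := le_lt_trans h3 h2; apply/negP; rewrite -leNgt lerD2l.
by rewrite ler_wpM2l // cum_le.
Qed.

Let I_cover h w : I h w -> exists x, I (x :: h) w.
Proof.
move=> /andP[h1 h2].
pose Q k := w < lo h + wt h * cum h k.
have exQ : exists k, Q k by exists #|T|; rewrite /Q cumT mulr1.
have [k Qk kmin] := ex_minnP exQ.
case: k Qk kmin => [|k] Qk kmin.
  by move: Qk; rewrite /Q cum0 mulr0 addr0 ltNge h1.
have kT : (k < #|T|)%N by apply: (kmin #|T|); rewrite /Q cumT mulr1.
exists (enum_val (Ordinal kT)); apply/IE; rewrite enum_valK /=; apply/andP; split=> //.
by rewrite leNgt; apply/negP => /kmin; rewrite ltnn.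
Qed.

Let H_in n w : I [::] w -> I (H n w) w.
Proof.
move=> w01; elim: n => //= n IH; case: pickP => [x /asboolP//|no].
by have [x Ix] := I_cover IH; move: (no x) => /asboolP.
Qed.

Let H_eq n h w : size h = n -> I h w -> H n w = h.
Proof.
elim: n h => [|n IH] [|x h] //= [sh] Ih; rewrite (IH h) //; last exact: I_sub Ih.
congr (_ :: _); case: pickP => [y /asboolP Iy|/(_ x)/asboolP//].
exact: I_disj Iy Ih.
Qed.

Let I_subT h w : I h w -> I [::] w.
Proof. by elim: h => // x h IH /I_sub. Qed.

Let H_out n w : ~ I [::] w -> H n w = nseq n t0.
Proof.
move=> w01; elim: n => //= n ->; congr (_ :: _).
by case: pickP => // x /asboolP/I_subT.
Qed.

Let size_H n w : size (H n w) = n.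
Proof. by elim: n => //= n ->. Qed.

Let HE n h : size h = n ->
  [set w | H n w = h] = I h `|` (if h == nseq n t0 then ~` I [::] else set0).
Proof.
move=> sh; apply/seteqP; split=> w /=.
  case: (pselect (I [::] w)) => [wI|wO] <-; first by left; exact: H_in.
  by rewrite H_out // eqxx; right.
case=> [Ih|]; first exact: (H_eq sh Ih).
by case: eqP => //= ->; exact: H_out.
Qed.

Let I_itv h : I h = [set` `[lo h, lo h + wt h[].
Proof. by apply/seteqP; split=> w; rewrite /I /= in_itv. Qed.

Let mI h : measurable (I h).
Proof. by rewrite I_itv. Qed.

Let mH n h : measurable [set w | H n w = h].
Proof.
have [sh|nsh] := eqVneq (size h) n; last first.
  rewrite (_ : [set _ | _] = set0) //; apply/seteqP; split=> w //= E.
  by move: nsh; rewrite -E size_H eqxx.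
rewrite HE //; apply: measurableU => //; case: ifP => // _.
exact: measurableC.
Qed.

Let Q : probability (measurableTypeR R) R := uniform_prob (@ltr01 R).

Let QI h : Q (I h) = (wt h)%:E.
Proof.
have lo_wt : 0 <= lo h /\ lo h + wt h <= 1.
  elim: h => [|x h [IH1 IH2]] /=; first by rewrite add0r.
  split; first by rewrite addr_ge0 // mulr_ge0 // -(cum0 h) cum_le.
  rewrite -addrA -mulrDr -cumS; apply: le_trans IH2; rewrite lerD2l.
  by rewrite -[leRHS]mulr1 ler_wpM2l // -(cumT h) cum_le.
rewrite /Q /= /uniform_prob (eq_integral (cst 1%E)); last first.
  move=> w; rewrite inE I_itv /= in_itv /= => /andP[h1 h2].
  rewrite /uniform_pdf subr0 invr1 ifT //.
  by case: lo_wt => l1 l2; apply/andP; split; lra.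
rewrite integral_cst; last exact: mI.
rewrite mul1e I_itv /= lebesgue_measure_itv /= lte_fin ltrDl.
case: ltP => [_|w0]; first by rewrite -EFinB; congr EFin; ring.
by congr EFin; apply/eqP; rewrite eq_le wt_ge0 w0.
Qed.

Let QH h : Q [set w | H (size h) w = h] = (wt h)%:E.
Proof.
rewrite HE // -QI; case: ifP => _; last by rewrite setU0.
rewrite measureU; last 3 first.
- exact: mI.
- by apply: measurableC; exact: mI.
- by apply/seteqP; split=> w //= [/I_subT].
rewrite [X in (_ + X)%E](_ : _ = 0%E) ?adde0 //.
apply: (etrans (@probability_setC _ _ _ Q (I [::]) (mI _))).
by rewrite (QI [::]) -EFinB subrr.
Qed.

Lemma markov_chain_exists : exists X : nat -> R -> T,
  [/\ forall n x, measurable [set w | X n w = x],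
      forall x, Q [set w | X 0%N w = x] = (q0 x)%:E
    & forall n (x : nat -> T),
      (Q [set w | forall t, (t <= n.+1)%N -> X t w = x t] =
       Q [set w | forall t, (t <= n)%N -> X t w = x t] *
       (K (x n) (x n.+1))%:E)%E].
Proof.
pose X n w := head t0 (H n.+1 w).
have XE n w : H n.+1 w = X n w :: H n w by [].
pose hp (x : nat -> T) := fix hp n := if n is m.+1 then x m :: hp m else [::].
have shp x n : size (hp x n) = n by elim: n => //= n ->.
have histE x n : [set w | forall t, (t <= n)%N -> X t w = x t] =
    [set w | H n.+1 w = hp x n.+1].
  apply/seteqP; split=> w /=.
    elim: n => [|n IH] hyp; first by rewrite -[X in X :: _]/(X 0%N w) hyp.
    rewrite -[LHS]/(X n.+1 w :: H n.+1 w) hyp // [H n.+1 w]IH // => t tn.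
    by apply: hyp; rewrite leqW.
  elim: n => [|n IH].
    by move=> /(congr1 (head t0)) /= E t; rewrite leqn0 => /eqP ->.
  move=> E t; rewrite leq_eqVlt => /predU1P[->|].
    by have := congr1 (head t0) E.
  rewrite ltnS => tn; apply: IH => //.
  by have := congr1 behead E.
exists X; split.
- move=> n x.
  have -> : [set w | X n w = x] =
      \big[setU/set0]_(h : n.-tuple T) [set w | H n.+1 w = x :: h].
    apply/seteqP; split=> w /=.
      move=> Xx; rewrite -bigcup_seq /=; exists (Tuple (introT eqP (size_H n w))).
        exact: mem_index_enum.
      by rewrite -Xx.
    by rewrite -bigcup_seq /= => -[h _ /(congr1 (head t0))].
  by apply: bigsetU_measurable => h _; exact: mH.
- move=> x; have := QH [:: x]; rewrite /= mul1r => <-; congr (Q _).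
  apply/seteqP; split=> w /=; first by rewrite -[X in X :: _]/(X 0%N w) => ->.
  by move=> /(congr1 (head t0)).
- move=> n x; rewrite !histE.
  have := QH (hp x n.+2); rewrite shp => ->.
  have := QH (hp x n.+1); rewrite shp => ->.
  by rewrite -EFinM.
Qed.
End MarkovChain.

Record mfg (R : realType) (S A : finType) := MFG {
  mfg_P : S -> A -> dist R S -> dist R S;
  mfg_r : S -> A -> dist R S -> R;
  mfg_gamma : R;
  mfg_r_bounded : forall s a z, `|mfg_r s a z| <= 1;
  mfg_gamma_gt0 : 0 < mfg_gamma;
  mfg_gamma_lt1 : mfg_gamma < 1
}.

Definition strategy (R : realType) (S A : finType) := S -> dist R A.

Section Model.
Variables (R : realType) (S A : finType) (G : mfg R S A).
Implicit Types (z : dist R S) (mu : strategy R S A).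

Definition mckean_vlasov_fun z mu : {ffun S -> R} :=
  [ffun s' => \sum_(s : S) \sum_(a : A) z s * mu s a * mfg_P G s a z s'].

Lemma mckean_vlasov_subproof z mu :
  [forall s', 0 <= mckean_vlasov_fun z mu s'] &&
  (\sum_s' mckean_vlasov_fun z mu s' == 1).
Proof.
apply/andP; split.
  apply/forallP => s'; rewrite ffunE; apply: sumr_ge0 => s _.
  by apply: sumr_ge0 => a _; rewrite !mulr_ge0 ?dist_ge0.
under eq_bigr do rewrite ffunE.
rewrite exchange_big /= -(dist_sum z); apply/eqP; apply: eq_bigr => s _.
rewrite exchange_big /=.
under eq_bigr do rewrite -mulr_sumr dist_sum mulr1.
by rewrite -mulr_sumr dist_sum mulr1.
Qed.

Definition mckean_vlasov z mu : dist R S := Dist (mckean_vlasov_subproof z mu).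

(* The state-action process X on the probability space (W, Q) is a trajectory
   from s0 under mu with the mean field frozen at z: s_0 = s0,
   a_t ~ mu(s_t, .) and s_{t+1} ~ P(. | s_t, a_t, z) given the past. *)
Definition is_trajectory d (W : measurableType d) (Q : probability W R)
    mu z (s0 : S) (X : nat -> W -> S * A) : Prop :=
  [/\ forall t x, measurable [set w | X t w = x],
      forall x, Q [set w | X 0%N w = x] = ((x.1 == s0)%:R * mu x.1 x.2)%:E
    & forall n (x : nat -> S * A),
      (Q [set w | forall t, (t <= n.+1)%N -> X t w = x t] =
       Q [set w | forall t, (t <= n)%N -> X t w = x t] *
       (mfg_P G (x n).1 (x n).2 z (x n.+1).1 *
        mu (x n.+1).1 (x n.+1).2)%:E)%E].

Lemma trajectory_exists mu z (s0 : S) :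
  exists X : nat -> measurableTypeR R -> S * A,
    is_trajectory (uniform_prob (@ltr01 R)) mu z s0 X.
Proof.
pose q0 (x : S * A) : R := (x.1 == s0)%:R * mu x.1 x.2.
pose K (x y : S * A) : R := mfg_P G x.1 x.2 z y.1 * mu y.1 y.2.
have q0_sum : \sum_x q0 x = 1.
  rewrite -(pair_bigA _ (fun s a => (s == s0)%:R * mu s a)) /=.
  under eq_bigr do rewrite -mulr_sumr dist_sum mulr1.
  rewrite (bigD1 s0) //= eqxx big1 ?addr0 // => s /negbTE -> //.
have K_sum x : \sum_y K x y = 1.
  rewrite -(pair_bigA _ (fun s a => mfg_P G x.1 x.2 z s * mu s a)) /=.
  under eq_bigr do rewrite -mulr_sumr dist_sum mulr1.
  exact: dist_sum.
have [t0 _] : exists t0 : S * A, true.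
  case: (pickP (fun _ : S * A => true)) => [t0 _|no]; first by exists t0.
  by move/eqP: q0_sum; rewrite big_pred0 // eq_sym oner_eq0.
apply: (@markov_chain_exists R _ t0 q0 K) => //.
- by move=> x; rewrite mulr_ge0 ?dist_ge0 ?ler0n.
- by move=> x y; rewrite mulr_ge0 ?dist_ge0.
Qed.

Definition discounted_return (W : Type) z (X : nat -> W -> S * A) (w : W) : R :=
  limn (series (fun t => mfg_gamma G ^+ t * mfg_r G (X t w).1 (X t w).2 z)).

(* V_{mu,z}(s); the expectation depends only on the law of the trajectory, so
   the choice of one is immaterial. *)
Definition value mu z (s : S) : R :=
  fine ('E_(uniform_prob (@ltr01 R))
    [discounted_return z (projT1 (cid (trajectory_exists mu z s)))]).

Definition trembling (eps : R) mu : Prop :=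
  forall s, exists a_s, mu s a_s = 1 - eps /\
    forall a, a != a_s -> mu s a = eps / (#|A|%:R - 1).

(* Psi(z): one strategy attains the maximum over Pi^eps at every state. *)
Definition best_response (eps : R) z mu : Prop :=
  trembling eps mu /\
  forall nu, trembling eps nu -> forall s, value nu z s <= value mu z s.

Definition is_TMFE (eps : R) mu z : Prop :=
  [/\ trembling eps mu, best_response eps z mu & z = mckean_vlasov z mu].

End Model.

Section StrategicComplementarities.
Context (R : realType) (dS dA : Order.disp_t).
Variables (S : finLatticeType dS) (A : finLatticeType dA) (G : mfg R S A).

Let leS (s s' : S) : Prop := (s <= s')%O.
Let leA (a a' : A) : Prop := (a <= a')%O.
Let leSA (x x' : S *p A) : Prop := (x <= x')%O.

(* In sc_r_max_nondecreasing the sup is over a finite set, i.e. it is the max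
   over actions as soon as A is nonempty. *)
Record strategic_complementarities : Prop := StrategicComplementarities {
  sc_r_nondecreasing : forall a z,
    nondecreasing_for leS (fun s => mfg_r G s a z);
  sc_r_supermodular : forall z,
    supermodular (fun x : S *p A => mfg_r G x.1 x.2 z);
  sc_r_increasing_differences :
    increasing_differences leSA (@sd_le R dS S)
      (fun x z => mfg_r G x.1 x.2 z);
  sc_r_max_nondecreasing : forall z,
    nondecreasing_for leS (fun s => sup (range (fun a => mfg_r G s a z)));
  sc_P_supermodular : forall z,
    stoch_supermodular (fun x : S *p A => mfg_P G x.1 x.2 z);
  sc_P_increasing_differences :
    stoch_increasing_differences leSA (@sd_le R dS S)
      (fun x z => mfg_P G x.1 x.2 z);
  sc_P_nondecreasing_s : forall a z,
    stoch_nondecreasing leS (fun s => mfg_P G s a z);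
  sc_P_nondecreasing_a : forall s z,
    stoch_nondecreasing leA (fun a => mfg_P G s a z);
  sc_P_nondecreasing_z : forall s a,
    stoch_nondecreasing (@sd_le R dS S) (fun z => mfg_P G s a z)
}.

End StrategicComplementarities.

(* Main.v *)
Require Import Defs.
From HB Require Import structures.
From mathcomp Require Import all_boot all_order all_algebra.
From mathcomp Require Import all_classical all_reals all_analysis.
From mathcomp Require Import measurable_realfun lra ring.

Set Implicit Arguments.
Unset Strict Implicit.
Unset Printing Implicit Defensive.

Import Order.TTheory GRing.Theory Num.Theory.
Import numFieldNormedType.Exports.
Local Open Scope classical_set_scope.
Local Open Scope ring_scope.

(** The largest best reply to a mean field is monotone, so the equilibrium is a
fixed point of a monotone map and no continuity in the mean field is needed.

A trembling-hand strategy with intended action [a] is the mixture which plays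
[a] with weight [1 - eps - eps / (#|A| - 1)], which is positive, and otherwise draws an action
uniformly. Best replies in the set of trembling-hand strategies are therefore
ordinary optimal policies of a Markov decision process whose value [q z s a] of
intending [a] in state [s] averages the one-step values ([tremble]).

For a frozen mean field, the expected discounted return of a trajectory is the
limit of the iterates of the Bellman operator of the strategy
([policy_iterate_cvg]), by dominated convergence and by computing the
one-dimensional marginals of the trajectory. It is a fixed point of that
operator ([value_fixpoint]), and a subsolution always lies below a
supersolution ([policy_comparison]).

The value iterates for the trembling problem are non-decreasing in the state
and have increasing differences in state and mean field; both properties are
kept by the Bellman operator ([bellman_complementary]) and by limits, hence
hold for the optimal value. Consequently [q] is supermodular in [(s, a)] and has
increasing differences in [(s, a)] and [z], and Topkis' argument shows that the
optimal actions are closed under joins and that the largest one is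
non-decreasing in [s] and [z] ([largest_reply_mono]). The strategy which
intends it is a best response ([largest_strategy_best_response]), and the
induced map on mean fields is monotone ([mckean_vlasov_largest_mono]).

Distributions on a finite lattice need not form a lattice under stochastic
dominance, so Tarski's theorem does not apply. But every non-empty chain has a
least upper bound ([sd_chain_lub]) and there is a least element, the point mass
at the bottom. Zorn's lemma applied to the distributions [z] dominated by their
image then yields a fixed point ([sd_fixpoint]). *)

(** * Finite sums and means *)

Lemma cvg_sum (R : realType) (T : Type) (F : set_system T) (FF : Filter F)
    (I : finType) (f : I -> T -> R) (l : I -> R) :
  (forall i, f i x @[x --> F] --> l i) ->
  \sum_i f i x @[x --> F] --> \sum_i l i.
Proof. by move=> fl; apply: cvg_big => // ; exact: add_continuous. Qed.

Section Means.
Context {R : realType} {X : finType}.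
Implicit Types (p : dist R X) (f g : X -> R).

Lemma mean_le_mean p f g :
  (forall x, f x <= g x) -> \sum_x f x * p x <= \sum_x g x * p x.
Proof. by move=> fg; apply: ler_sum => x _; rewrite ler_wpM2r ?dist_ge0. Qed.

Lemma mean_cst p c : \sum_x c * p x = c.
Proof. by rewrite -mulr_sumr dist_sum mulr1. Qed.

Lemma mean_le p f c : (forall x, f x <= c) -> \sum_x f x * p x <= c.
Proof.
move=> fc; rewrite -[leRHS]mulr1 -(dist_sum p) mulr_sumr.
by apply: ler_sum => x _; rewrite ler_wpM2r // dist_ge0.
Qed.

End Means.

(** * The value of a strategy *)

(** Additivity over the fibers of a random variable with finitely many values. *)
Lemma measure_fibers (R : realType) d (W : measurableType d)
    (Q : {measure set W -> \bar R}) (T : finType) (Y : W -> T) (E : set W) :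
    (forall y, measurable [set w | Y w = y]) -> measurable E ->
  Q E = (\sum_y Q (E `&` [set w | Y w = y]))%E.
Proof.
move=> mY mE.
have {1}-> : E = \bigcup_(y in [set` index_enum T]) (E `&` [set w | Y w = y]).
  apply/seteqP; split=> [w Ew|w [y _ []]//].
  by exists (Y w) => //=; exact: mem_index_enum.
rewrite measure_fin_bigcup //; last 2 first.
- apply/trivIsetP => i j _ _ /eqP ij; apply/seteqP; split=> // w /= [[_ Yi] [_ Yj]].
  by apply: ij; rewrite -Yi.
- by move=> y _; apply: measurableI.
by rewrite (fsbig_seq _ _ (index_enum_uniq T)).
Qed.

Section PolicyEvaluation.
Context {R : realType} {S A : finType} (G : mfg R S A).
Implicit Types (z : dist R S) (mu : strategy R S A) (v : S -> R).

(** One-step value: the reward of [a] in [s] plus the discounted mean of [v] over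
the next state. *)
Definition action_value z v s a : R :=
  mfg_r G s a z + mfg_gamma G * \sum_s' v s' * mfg_P G s a z s'.

(** Bellman operator of the strategy [mu] with the mean field frozen at [z]. *)
Definition policy_operator mu z v s : R :=
  \sum_a mu s a * action_value z v s a.

Section Trajectory.
Context d (W : measurableType d) (Q : probability W R).
Variables (mu : strategy R S A) (z : dist R S) (s0 : S) (X : nat -> W -> S * A).
Hypothesis trajX : is_trajectory G Q mu z s0 X.

(* [K] is the transition kernel of the state-action process, [Kop] its action on
   functions, and [p n] the law of the process at time [n]. *)
Let K (x y : S * A) : R := mfg_P G x.1 x.2 z y.1 * mu y.1 y.2.
Let p n x : R := fine (Q [set w | X n w = x]).
Let Kop (f : S * A -> R) x : R := \sum_y K x y * f y.

Let mX n x : measurable [set w | X n w = x].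
Proof. by case: trajX. Qed.

Let pE n x : Q [set w | X n w = x] = (p n x)%:E.
Proof. by rewrite /p fineK // fin_num_measure. Qed.

Let joint n x y : Q ([set w | X n w = x] `&` [set w | X n.+1 w = y]) =
  (p n x * K x y)%:E.
Proof.
(* Condition on the history [Y] strictly before time [n]: on each of its fibers
   the Markov property of the trajectory applies to a full path. *)
pose Y w := [ffun i : 'I_n => X i w].
have mY h : measurable [set w | Y w = h].
  have -> : [set w | Y w = h] = \bigcap_(i in [set: 'I_n]) [set w | X i w = h i].
    apply/seteqP; split=> w /=.
      by move=> <- i _ /=; rewrite ffunE.
    by move=> H; apply/ffunP => i; rewrite ffunE; apply: H.
  exact: fin_bigcap_measurable.
rewrite (measure_fibers Q mY) //; last exact: measurableI.
rewrite EFinM -pE (measure_fibers Q mY) //.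
rewrite ge0_sume_distrl //; apply: eq_bigr => h _.
pose path t := if insub t is Some i then h (i : 'I_n)
  else if t == n then x else y.
case: trajX => _ _ /(_ n path).
have pn : path n = x by rewrite /path insubF ?ltnn ?eqxx.
have pn1 : path n.+1 = y.
  by rewrite /path insubF ?eqn_leq ?ltnn // ltnNge leqnSn.
have pi (i : 'I_n) : path i = h i by rewrite /path valK.
have En : [set w | forall t, (t <= n)%N -> X t w = path t] =
    [set w | X n w = x] `&` [set w | Y w = h].
  apply/seteqP; split=> w /=.
    move=> H; split; first by rewrite H.
    by apply/ffunP => i; rewrite ffunE H // ltnW.
  move=> [Xn Yw] t; rewrite leq_eqVlt => /predU1P[->|tn]; first by rewrite Xn.
  by rewrite -[t]/(val (Ordinal tn)) pi -Yw ffunE.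
rewrite pn pn1 En => <-; congr (Q _).
apply/seteqP; split=> w /=.
  move=> [[Xn Xn1] Yw] t; rewrite leq_eqVlt => /predU1P[->|]; first by rewrite pn1.
  rewrite ltnS leq_eqVlt => /predU1P[->|tn]; first by rewrite Xn.
  by rewrite -[t]/(val (Ordinal tn)) pi -Yw ffunE.
move=> H; split; first by rewrite !H ?pn ?pn1.
apply/ffunP => i; rewrite ffunE H ?pi //.
exact: leqW (ltnW (ltn_ord i)).
Qed.

Let pS n y : p n.+1 y = \sum_x p n x * K x y.
Proof.
apply: EFin_inj; rewrite -pE (measure_fibers Q (mX n)) // -sumEFin.
by apply: eq_bigr => x _; rewrite -joint setIC.
Qed.

(* Means at time [n] are computed backwards, by iterating [Kop] on the test
   function. *)
Let p_iter n f : \sum_x p n x * f x = \sum_a mu s0 a * iter n Kop f (s0, a).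
Proof.
elim: n f => [|n IH] f /=.
  have p0 x : p 0 x = (x.1 == s0)%:R * mu x.1 x.2.
    by rewrite /p; case: trajX => _ -> _.
  transitivity (\sum_x (x.1 == s0)%:R * mu x.1 x.2 * f (x.1, x.2)).
    by apply: eq_bigr => -[s a] _; rewrite p0.
  rewrite -(pair_bigA _ (fun s a => (s == s0)%:R * mu s a * f (s, a))) /=.
  rewrite (bigD1 s0) //= [X in _ + X]big1 ?addr0.
    by apply: eq_bigr => a _; rewrite eqxx mul1r.
  by move=> s /negbTE ->; rewrite big1 // => a _; rewrite !mul0r.
rewrite -iterS iterSr -IH.
under eq_bigr do rewrite pS mulr_suml.
rewrite exchange_big /=; apply: eq_bigr => x _.
by rewrite mulr_sumr; apply: eq_bigr => y _; rewrite mulrA.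
Qed.

(* Expected reward at time [t] from the initial state [s]. *)
Let occupation t s : R :=
  \sum_a mu s a * iter t Kop (fun x => mfg_r G x.1 x.2 z) (s, a).

Let occupationS t s :
  occupation t.+1 s = \sum_a mu s a * \sum_s' occupation t s' * mfg_P G s a z s'.
Proof.
apply: eq_bigr => a _; congr (_ * _); rewrite iterS.
set f := iter t _ _.
transitivity (\sum_y mfg_P G s a z y.1 * mu y.1 y.2 * f (y.1, y.2)).
  by apply: eq_bigr => -[].
rewrite -(pair_bigA _ (fun s' a' => mfg_P G s a z s' * mu s' a' * f (s', a'))) /=.
apply: eq_bigr => s' _; rewrite mulr_suml; apply: eq_bigr => a' _.
by rewrite [RHS]mulrC mulrA.
Qed.

Let sum_occupation n s :
  \sum_(t < n) mfg_gamma G ^+ t * occupation t s =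
  iter n (policy_operator mu z) (fun=> 0) s.
Proof.
elim: n s => [|n IH] s; first by rewrite big_ord0.
rewrite big_ord_recl expr0 mul1r iterS /policy_operator /action_value.
under [RHS]eq_bigr do rewrite mulrDr.
rewrite big_split /=; congr (_ + _).
under [RHS]eq_bigr do under eq_bigr do rewrite -IH mulr_suml.
under [RHS]eq_bigr do rewrite exchange_big mulr_sumr mulr_sumr.
rewrite exchange_big; apply: eq_bigr => t _.
rewrite -[bump 0 t]/t.+1 occupationS exprS mulr_sumr; apply: eq_bigr => a _.
rewrite mulrCA; congr (_ * _); rewrite -mulrA; congr (_ * _); rewrite mulr_sumr.
by apply: eq_bigr => s' _; rewrite mulrA.
Qed.

Let partial_return n w : R :=
  series (fun t => mfg_gamma G ^+ t * mfg_r G (X t w).1 (X t w).2 z) n.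

Let rX t w : mfg_r G (X t w).1 (X t w).2 z =
  \sum_x mfg_r G x.1 x.2 z * \1_[set w | X t w = x] w.
Proof.
rewrite (bigD1 (X t w)) //= indicE mem_set // mulr1 big1 ?addr0 // => x xX.
by rewrite indicE memNset ?mulr0 //= => xE; rewrite xE eqxx in xX.
Qed.

Let measurable_partial_return n : measurable_fun setT (partial_return n).
Proof.
rewrite /partial_return /series /=; apply: measurable_sum => t.
apply: measurable_funM => //.
under eq_fun do rewrite rX.
apply: measurable_sum => x; apply: measurable_funM => //.
Qed.

Let g0 := ltW (mfg_gamma_gt0 G).
Let g1 := mfg_gamma_lt1 G.

Let geometric_le n : series (fun t => mfg_gamma G ^+ t) n <= (1 - mfg_gamma G)^-1.
Proof.
have -> : (fun t => mfg_gamma G ^+ t) = geometric 1 (mfg_gamma G).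
  by apply/funext => t; rewrite /= mul1r.
rewrite geometric_seriesE ?lt_eqF //= mul1r ler_piMl //.
  by rewrite invr_ge0 subr_ge0 ltW.
by rewrite lerBlDr lerDl exprn_ge0.
Qed.

Let partial_return_le n w : `|partial_return n w| <= (1 - mfg_gamma G)^-1.
Proof.
apply: le_trans (geometric_le n); apply: le_trans (ler_norm_sum _ _ _) _.
apply: ler_sum => t _; rewrite normrM ger0_norm ?exprn_ge0 //.
by rewrite ler_piMr ?exprn_ge0 // mfg_r_bounded.
Qed.

Let partial_return_cvg w :
  partial_return n w @[n --> \oo] --> discounted_return G z X w.
Proof.
apply: (@normed_cvg R R^o); apply: nondecreasing_is_cvgn.
  by apply: nondecreasing_series => n _; rewrite normr_ge0.
exists (1 - mfg_gamma G)^-1 => _ [n _ <-]; apply: le_trans (geometric_le n).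
apply: ler_sum => t _; rewrite /= normrM ger0_norm ?exprn_ge0 //.
by rewrite ler_piMr ?exprn_ge0 // mfg_r_bounded.
Qed.

Let integral_partial_return n :
  (\int[Q]_w (partial_return n w)%:E =
   (\sum_(t < n) mfg_gamma G ^+ t * occupation t s0)%:E)%E.
Proof.
have intI t x (c : R) : Q.-integrable setT
    (fun w => (c * \1_[set w | X t w = x] w)%:E).
  apply: (@integrableZl _ _ _ Q setT measurableT c (EFin \o \1_[set w | X t w = x])).
  exact: integrable_indic.
have intE t x (c : R) :
    (\int[Q]_w (c * \1_[set w | X t w = x] w)%:E = (c * p t x)%:E)%E.
  rewrite (@integralZl _ _ _ Q setT measurableT (EFin \o \1_[set w | X t w = x])).
    by rewrite integral_indic // setIT EFinM -pE.
  exact: integrable_indic.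
pose c t (x : S * A) := mfg_gamma G ^+ t * mfg_r G x.1 x.2 z.
transitivity (\int[Q]_w \sum_(0 <= t < n)
    (\sum_x (c t x * \1_[set w | X t w = x] w)%:E))%E.
  apply: eq_integral => w _; rewrite /partial_return /series /= -sumEFin.
  apply: eq_bigr => t _; rewrite sumEFin rX mulr_sumr.
  by congr EFin; apply: eq_bigr => x _; rewrite mulrA.
rewrite integral_sum // => [|t]; last exact: integrable_sum.
rewrite big_mkord -sumEFin; apply: eq_bigr => t _.
rewrite integral_sum //; under eq_bigr do rewrite intE.
rewrite sumEFin; congr EFin; rewrite /occupation -p_iter mulr_sumr.
by apply: eq_bigr => x _; rewrite -mulrA [X in _ * X]mulrC.
Qed.

(** The partial sums of the return are bounded by [(1 - gamma)^-1], so their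
expectations converge to that of the return; these expectations are the
iterates of the Bellman operator at the null function. *)
Lemma expected_return_cvg :
  iter n (policy_operator mu z) (fun=> 0) s0 @[n --> \oo] -->
  fine ('E_Q[discounted_return G z X]).
Proof.
rewrite unlock.
have [] := @dominated_convergence _ _ _ Q setT measurableT
  (fun n w => (partial_return n w)%:E) (fun w => (discounted_return G z X w)%:E)
  (fun=> ((1 - mfg_gamma G)^-1)%:E).
- by move=> n; apply/measurable_EFinP.
- by apply/measurable_EFinP; apply: measurable_fun_cvg => [n|w _];
    [exact: measurable_partial_return|exact: partial_return_cvg].
- by apply: aeW => w _; apply: cvg_EFin; [exact: nearW|exact: partial_return_cvg].
- exact: finite_measure_integrable_cst.
- by apply: aeW => w n _; rewrite /= lee_fin.
move=> int_return _ cvgI.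
have := @fine_cvg _ _ _ _ (fun n => (iter n (policy_operator mu z) (fun=> 0) s0)%:E).
apply; rewrite fineK; last exact: integrable_fin_num.
apply: cvg_trans cvgI; apply: near_eq_cvg; apply: nearW => n /=.
by rewrite integral_partial_return sum_occupation.
Qed.

End Trajectory.

Lemma policy_iterate_cvg mu z s :
  iter n (policy_operator mu z) (fun=> 0) s @[n --> \oo] --> value G mu z s.
Proof. by apply: expected_return_cvg; exact: (projT2 (cid _)). Qed.

Lemma policy_operator_cvg mu z (v_ : nat -> S -> R) (v : S -> R) :
    (forall s, v_ n s @[n --> \oo] --> v s) ->
  forall s, policy_operator mu z (v_ n) s @[n --> \oo] --> policy_operator mu z v s.
Proof.
move=> vcvg s; apply: cvg_sum => a.
apply: cvgM; first exact: cvg_cst.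
apply: cvgD; first exact: cvg_cst.
apply: cvgM; first exact: cvg_cst.
by apply: cvg_sum => s'; apply: cvgM => //; exact: cvg_cst.
Qed.

(** Policy evaluation equation. *)
Lemma value_fixpoint mu z s :
  value G mu z s = policy_operator mu z (value G mu z) s.
Proof.
have cvg1 := @policy_operator_cvg mu z _ _ (@policy_iterate_cvg mu z) s.
apply: cvg_unique cvg1 => //.
have := @policy_iterate_cvg mu z s; rewrite -cvg_shiftS; exact.
Qed.

End PolicyEvaluation.

(** * Fixed points for stochastic dominance *)

Section StochasticDominance.
Context {R : realType} d (X : finPOrderType d).
Implicit Types (p q : dist R X) (f : X -> R).

Lemma sd_le_refl p : sd_le p p.
Proof. by move=> f _. Qed.

Lemma sd_le_trans q p p' : sd_le p q -> sd_le q p' -> sd_le p p'.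
Proof. by move=> pq qp' f f_homo; exact: le_trans (pq f f_homo) (qp' f f_homo). Qed.

Lemma up_homo (x : X) :
  {homo (fun y => (x <= y)%O%:R : R) : y z / (y <= z)%O >-> y <= z}.
Proof.
by move=> y z yz; rewrite ler_nat; case: (boolP (x <= y)%O) => // /le_trans ->.
Qed.

Lemma strict_up_homo (x : X) :
  {homo (fun y => (x < y)%O%:R : R) : y z / (y <= z)%O >-> y <= z}.
Proof.
by move=> y z yz; rewrite ler_nat; case: (boolP (x < y)%O) => // /lt_le_trans ->.
Qed.

(** Up-sets determine a distribution. *)
Lemma dist_up_sub p x :
  p x = \sum_y (x <= y)%O%:R * p y - \sum_y (x < y)%O%:R * p y.
Proof.
rewrite -sumrB (bigD1 x) //= lexx ltxx mul1r mul0r subr0 big1 ?addr0 // => y yx.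
by rewrite lt_neqAle eq_sym yx subrr.
Qed.

Lemma sd_le_anti p q : sd_le p q -> sd_le q p -> p = q.
Proof.
move=> pq qp; apply/val_inj/ffunP => x /=; rewrite !dist_up_sub.
by congr (_ - _); apply/eqP; rewrite eq_le ?(pq _ (up_homo x)) ?(qp _ (up_homo x))
  ?(pq _ (strict_up_homo x)) ?(qp _ (strict_up_homo x)).
Qed.

(** The mean of a non-decreasing [f] increases along the chain, hence converges
to its supremum; the masses of points, differences of masses of up-sets,
converge too and their limits form the least upper bound. *)
Lemma sd_chain_lub (C : set (dist R X)) : C !=set0 ->
    (forall p q, C p -> C q -> sd_le p q \/ sd_le q p) ->
  exists2 z, (forall p, C p -> sd_le p z) &
    forall w, (forall p, C p -> sd_le p w) -> sd_le z w.
Proof.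
move=> [p0 Cp0] Ctot.
(* The filter of final segments of the chain. *)
pose F := filter_from C (fun p => [set q | C q /\ sd_le p q]).
have FF : Filter F.
  apply: filter_from_filter; first by exists p0.
  move=> p q Cp Cq; have [pq|qp] := Ctot _ _ Cp Cq.
    by exists q => // w [Cw qw]; split; split => //; exact: sd_le_trans qw.
  by exists p => // w [Cw pw]; split; split => //; exact: sd_le_trans pw.
have PF : ProperFilter F.
  by apply: filter_from_proper => p Cp; exists p; split => //; exact: sd_le_refl.
pose E f q := \sum_x f x * q x.
have ubE f p : E f p <= \sum_x `|f x|.
  apply: mean_le => x; apply: le_trans (ler_norm _) _.
  by rewrite (bigD1 x) //= lerDl sumr_ge0.
have cvgE f : {homo f : x y / (x <= y)%O >-> x <= y} ->
    E f q @[q --> F] --> sup [set E f q | q in C].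
  move=> f_homo.
  have hs : has_sup [set E f q | q in C].
    split; first by exists (E f p0), p0.
    by exists (\sum_x `|f x|) => _ [q _ <-].
  apply/cvgrPdist_le => e e0.
  have [_ [p Cp <-] pe] := sup_adherent e0 hs.
  exists p => // q [Cq pq] /=; rewrite ler_distlC.
  have Eq_le : E f q <= sup [set E f q | q in C].
    by apply: ub_le_sup; [case: hs|exists q].
  apply/andP; split; first exact: le_trans (ltW pe) (pq f f_homo).
  by apply: le_trans Eq_le _; rewrite lerDl ltW.
pose l x := sup [set E (fun y => (x <= y)%O%:R) q | q in C] -
            sup [set E (fun y => (x < y)%O%:R) q | q in C].
have cvgl x : (q : dist R X) x @[q --> F] --> l x.
  rewrite (_ : (fun q : dist R X => q x) = fun q =>
    E (fun y => (x <= y)%O%:R) q - E (fun y => (x < y)%O%:R) q); last first.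
    by apply/funext => q; exact: dist_up_sub.
  by apply: cvgB; apply: cvgE; [exact: up_homo|exact: strict_up_homo].
have z_dist : [forall x, 0 <= [ffun x => l x] x] && (\sum_x [ffun x => l x] x == 1).
  apply/andP; split.
    apply/forallP => x; rewrite ffunE -(cvg_lim _ (cvgl x)) //.
    apply: limr_ge; first exact: cvgP (cvgl x).
    by exists p0 => // q _ /=; exact: dist_ge0.
  under eq_bigr do rewrite ffunE.
  apply/eqP; apply: (@cvg_unique _ _ (\sum_x (q : dist R X) x @[q --> F])) => //.
    exact: cvg_sum.
  rewrite (_ : (fun q : dist R X => \sum_x q x) = cst 1); last first.
    by apply/funext => q; exact: dist_sum.
  exact: cvg_cst.
pose z := Dist z_dist.
have cvgz f : E f q @[q --> F] --> E f z.
  by apply: cvg_sum => x; apply: cvgM; [exact: cvg_cst|rewrite /= ffunE].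
exists z.
  move=> p Cp f f_homo; rewrite -[leRHS](cvg_lim _ (cvgz f)) //.
  apply: limr_ge; first exact: cvgP (cvgz f).
  by exists p => // q [_ pq]; exact: pq.
move=> w w_ub f f_homo; rewrite -[leLHS](cvg_lim _ (cvgz f)) //.
apply: limr_le; first exact: cvgP (cvgz f).
by exists p0 => // q [Cq _]; exact: w_ub.
Qed.

Lemma dirac_subproof (x0 : X) :
  [forall x, 0 <= [ffun x => (x == x0)%:R : R] x] &&
  (\sum_x [ffun x => (x == x0)%:R : R] x == 1).
Proof.
apply/andP; split; first by apply/forallP => x; rewrite ffunE.
rewrite (bigD1 x0) //= ffunE eqxx big1 ?addr0 // => x /negbTE xx0.
by rewrite ffunE xx0.
Qed.

Lemma sd_le_bottom (bot : X) : (forall x, (bot <= x)%O) ->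
  exists z : dist R X, forall p, sd_le z p.
Proof.
move=> bot_le; exists (Dist (dirac_subproof bot)) => p f f_homo.
rewrite (bigD1 bot) //= ffunE eqxx mulr1 big1 ?addr0; last first.
  by move=> x /negbTE xb; rewrite ffunE xb mulr0.
rewrite -[leLHS]mulr1 -(dist_sum p) mulr_sumr; apply: ler_sum => x _.
by rewrite ler_wpM2r ?dist_ge0 // f_homo.
Qed.

(** A maximal element among the [z] dominated by [F z] is a fixed point, because
[F z] is then another such element. *)
Lemma sd_fixpoint (bot : X) (F : dist R X -> dist R X) :
    (forall x, (bot <= x)%O) ->
    (forall p q, sd_le p q -> sd_le (F p) (F q)) ->
  exists z, z = F z.
Proof.
move=> /sd_le_bottom[z0 z0_le] F_homo.
pose T := {z | sd_le z (F z)}.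
pose le (p q : T) := `[< sd_le (sval p) (sval q) >].
have [||||z zmax] := @Zorn T le.
- by move=> p; apply/asboolP; exact: sd_le_refl.
- by move=> p q r /asboolP pq /asboolP qr; apply/asboolP; exact: sd_le_trans qr.
- move=> [p Fp] [q Fq] /asboolP /= pq /asboolP /= qp.
  by apply: eq_exist; exact: sd_le_anti.
- move=> C Ctot; have [C0|/set0P/negP/negbNE/eqP C0] := pselect (C !=set0); last first.
    by exists (exist (fun z => sd_le z (F z)) z0 (z0_le _)) => p; rewrite C0.
  have [||z z_ub z_lub] := @sd_chain_lub [set sval p | p in C].
  + by case: C0 => p Cp; exists (sval p), p.
  + move=> _ _ [p Cp <-] [q Cq <-].
    by have [/asboolP|/asboolP] := Ctot _ _ Cp Cq; [left|right].
  have zF : sd_le z (F z).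
    apply: z_lub => _ [p Cp <-]; apply: sd_le_trans (svalP p) _.
    by apply/F_homo/z_ub; exists p.
  by exists (exist (fun z => sd_le z (F z)) z zF) => p Cp; apply/asboolP/z_ub; exists p.
have zFz := svalP z.
exists (sval z).
have := zmax (exist (fun z => sd_le z (F z)) (F (sval z)) (F_homo _ _ zFz)).
by move=> /(_ (asboolT zFz)) {1}<-.
Qed.

End StochasticDominance.

(** * Comparison of sub- and supersolutions *)

Section Comparison.
Context {R : realType} {S A : finType} (G : mfg R S A).
Implicit Types (z : dist R S) (mu : strategy R S A) (u v : S -> R).

Lemma action_value_mono z u v s a : (forall s', u s' <= v s') ->
  action_value G z u s a <= action_value G z v s a.
Proof.
move=> uv; rewrite lerD2l ler_wpM2l ?(ltW (mfg_gamma_gt0 _)) //.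
exact: mean_le_mean.
Qed.

Lemma action_valueDc z v s a c :
  action_value G z (fun s' => v s' + c) s a = action_value G z v s a + mfg_gamma G * c.
Proof.
rewrite /action_value; under eq_bigr do rewrite mulrDl.
by rewrite big_split /= mean_cst mulrDr addrA.
Qed.

(** Maximum principle: at a state where [u - v] is maximal, with maximum [m], the
hypotheses give [m <= gamma * m]. *)
Lemma policy_comparison mu z u v :
    (forall s, u s <= policy_operator G mu z u s) ->
    (forall s, policy_operator G mu z v s <= v s) ->
  forall s, u s <= v s.
Proof.
move=> uT Tv s.
pose s1 := [arg max_(s' > s) (u s' - v s')]%O.
have s1_max s' : u s' - v s' <= u s1 - v s1.
  by rewrite /s1; case: arg_maxP => // i _; apply.
set m := u s1 - v s1 in s1_max.
suff m0 : m <= 0 by rewrite -subr_le0; exact: le_trans (s1_max s) m0.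
have u_le s' : u s' <= v s' + m by rewrite -lerBlDl.
have Tu : policy_operator G mu z u s1 <= policy_operator G mu z v s1 + mfg_gamma G * m.
  rewrite -[X in _ + X](mean_cst (mu s1)) /policy_operator -big_split /=.
  apply: ler_sum => a _; rewrite [_ * m * _]mulrC -mulrDr ler_wpM2l ?dist_ge0 //.
  by rewrite -action_valueDc; exact: action_value_mono.
have : m <= mfg_gamma G * m.
  by have := uT s1; have := Tv s1; rewrite {1}/m; lra.
rewrite -subr_le0 -{1}[m]mul1r -mulrBl pmulr_rle0 // subr_gt0.
exact: mfg_gamma_lt1.
Qed.

End Comparison.

(** * Trembling-hand strategies *)

Section Tremble.
Context {R : realType} {A : finType} (eps : R).
Hypotheses (A_ge2 : (2 <= #|A|)%N) (eps_gt0 : 0 < eps)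
  (eps_small : eps / (#|A|%:R - 1) < 1 - eps).

Let delta := eps / (#|A|%:R - 1).

(** Mean of [f] under the trembling-hand distribution with intended action [a],
written as a mixture of the value at [a] and of a uniform part: the intended
action has probability [1 - eps] and any other [eps / (#|A| - 1)]. *)
Definition tremble (f : A -> R) (a : A) : R :=
  (1 - eps - eps / (#|A|%:R - 1)) * f a + eps / (#|A|%:R - 1) * \sum_b f b.

Let cardA : 0 < #|A|%:R - 1 :> R.
Proof. by rewrite subr_gt0 ltr1n. Qed.

Let delta_ge0 : 0 <= delta.
Proof. by rewrite divr_ge0 ?ltW. Qed.

Let weight_gt0 : 0 < 1 - eps - delta.
Proof. by rewrite subr_gt0. Qed.

Lemma tremble_mono (f g : A -> R) a b :
  (forall c, f c <= g c) -> f a <= f b -> tremble f a <= tremble g b.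
Proof.
move=> fg fab; apply: lerD; rewrite ler_wpM2l ?(ltW weight_gt0) //.
  exact: le_trans fab (fg b).
by apply: ler_sum => c _.
Qed.

(** Both supermodularity and increasing differences are inequalities of this
four-point form. *)
Lemma tremble_exchange (f1 f2 f3 f4 : A -> R) a1 a2 a3 a4 :
    (forall b, f1 b + f2 b <= f3 b + f4 b) ->
    f1 a1 + f2 a2 <= f3 a3 + f4 a4 ->
  tremble f1 a1 + tremble f2 a2 <= tremble f3 a3 + tremble f4 a4.
Proof.
move=> fb fa; rewrite /tremble addrACA [leRHS]addrACA -!mulrDr -!big_split /=.
apply: lerD; rewrite ler_wpM2l //.
- exact: ltW weight_gt0.
- exact: ler_sum.
Qed.

Lemma tremble_cst c a : tremble (fun=> c) a = c.
Proof.
have delta_eps : delta * (#|A|%:R - 1) = eps by rewrite divfK // gt_eqF.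
rewrite /tremble sumr_const -/delta -mulr_natr.
transitivity (c + c * (delta * (#|A|%:R - 1) - eps)); first by ring.
by rewrite delta_eps subrr mulr0 addr0.
Qed.

Definition tremble_ffun (a : A) : {ffun A -> R} :=
  [ffun b => if b == a then 1 - eps else delta].

Lemma tremble_mean (p : A -> R) a f :
    p a = 1 - eps -> (forall b, b != a -> p b = delta) ->
  \sum_b p b * f b = tremble f a.
Proof.
move=> pa pb; rewrite /tremble -/delta (bigD1 a) //= pa.
rewrite [in RHS](bigD1 a) //= mulrDr mulr_sumr.
under eq_bigr => b ba do rewrite (pb b ba).
by ring.
Qed.

Lemma tremble_dist_subproof a :
  [forall b, 0 <= tremble_ffun a b] && (\sum_b tremble_ffun a b == 1).
Proof.
apply/andP; split.
  apply/forallP => b; rewrite ffunE; case: ifP => // _.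
  by apply: le_trans delta_ge0 _; apply: ltW.
under eq_bigr do rewrite -[tremble_ffun a _]mulr1.
rewrite (@tremble_mean _ a) ?tremble_cst // ?ffunE ?eqxx // => b /negbTE ba.
by rewrite ffunE ba.
Qed.

(** The trembling-hand distribution with intended action [a]. *)
Definition tremble_dist a : dist R A := Dist (tremble_dist_subproof a).

Lemma tremble_dist_mean a f : \sum_b tremble_dist a b * f b = tremble f a.
Proof.
by apply: tremble_mean => [|b /negbTE ba] /=; rewrite ffunE ?eqxx ?ba.
Qed.

Lemma trembling_tremble_dist (S : finType) (phi : S -> A) :
  trembling eps (fun s => tremble_dist (phi s)).
Proof.
move=> s; exists (phi s); split=> [|b /negbTE ba] /=; by rewrite ffunE ?eqxx ?ba.
Qed.

End Tremble.

(** * Finite lattices *)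

Lemma bigjoin_ge d (L : latticeType d) (x0 x : L) (r : seq L) (P : pred L) :
  x \in r -> P x -> (x <= \big[Order.join/x0]_(y <- r | P y) y)%O.
Proof.
elim: r => // y r IH; rewrite inE big_cons => /predU1P[->|xr] Px.
  by rewrite Px leUl.
by case: ifP => _; [apply: le_trans (IH xr Px) (leUr _ _)|exact: IH].
Qed.

Lemma finlattice_bottom d (L : finLatticeType d) (x0 : L) :
  exists bot : L, forall x, (bot <= x)%O.
Proof.
exists (\big[Order.meet/x0]_(y <- enum L) y) => x.
have : x \in enum L by rewrite mem_enum.
elim: (enum L) => // y r IH; rewrite inE big_cons => /predU1P[->|xr].
  by rewrite leIl.
by apply: le_trans (leIr _ _) (IH xr).
Qed.

(** * Monotone optimal replies *)

Section Complementarities.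
Context {R : realType} {dS dA : Order.disp_t}.
Context {S : finLatticeType dS} {A : finLatticeType dA} {G : mfg R S A} {eps : R}.
Hypotheses (A_ge2 : (2 <= #|A|)%N) (eps_gt0 : 0 < eps)
  (eps_small : eps / (#|A|%:R - 1) < 1 - eps).
Hypothesis sc : strategic_complementarities G.
Variable a0 : A.
Implicit Types (z : dist R S) (v : dist R S -> S -> R) (s : S) (a : A).

Let gamma_ge0 : 0 <= mfg_gamma G := ltW (mfg_gamma_gt0 G).

(** The properties of a family of value functions preserved by the Bellman
operator: non-decreasing in the state, with increasing differences in state and
mean field. *)
Definition complementary v : Prop :=
  (forall z, {homo v z : s s' / (s <= s')%O >-> s <= s'}) /\
  (forall z z' s s', sd_le z z' -> (s <= s')%O ->
     v z' s + v z s' <= v z' s' + v z s).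

Local Notation h v z s a := (action_value G z (v z) s a).

(** Value of intending [a] in [s] when the continuation value is [v z]. *)
Definition trembling_value v z s a : R := tremble eps (action_value G z (v z) s) a.

Local Notation q := trembling_value.

(* The one-step values inherit their properties from [r] and [P], because the
   continuation value is a non-decreasing test function; [tremble] then passes
   them on to [q]. *)
Let h_mono_s v z s s' a : complementary v -> (s <= s')%O -> h v z s a <= h v z s' a.
Proof.
move=> [v_homo _] ss'; apply: lerD; first exact: (sc_r_nondecreasing sc).
by rewrite ler_wpM2l //; apply: (sc_P_nondecreasing_s sc).
Qed.

Let h_supermodular v z s s' a a' : complementary v ->
  h v z s a + h v z s' a' <=
  h v z (Order.join s s') (Order.join a a') + h v z (Order.meet s s') (Order.meet a a').
Proof.
move=> [v_homo _].
have := sc_r_supermodular sc z (s, a) (s', a').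
have := sc_P_supermodular sc z (v_homo z) (s, a) (s', a').
rewrite /action_value /= -(ler_pM2l (mfg_gamma_gt0 G)).
by lra.
Qed.

Let P_mono z (f : S -> R) s s' a a' :
    {homo f : x y / (x <= y)%O >-> x <= y} -> (s <= s')%O -> (a <= a')%O ->
  \sum_x f x * mfg_P G s a z x <= \sum_x f x * mfg_P G s' a' z x.
Proof.
move=> f_homo ss' aa'; apply: (@le_trans _ _ (\sum_x f x * mfg_P G s' a z x)).
  exact: (sc_P_nondecreasing_s sc).
exact: (sc_P_nondecreasing_a sc).
Qed.

Let h_increasing_differences v z z' s s' a a' : complementary v ->
    sd_le z z' -> (s <= s')%O -> (a <= a')%O ->
  h v z' s a + h v z s' a' <= h v z' s' a' + h v z s a.
Proof.
move=> [v_homo v_diff] zz' ss' aa'.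
have xx' : (((s, a) : S *p A) <= ((s', a') : S *p A))%O.
  by apply/andP.
have := sc_r_increasing_differences sc xx' zz'.
have := sc_P_increasing_differences sc (v_homo z') xx' zz'.
(* The second difference of the mean continuation value is that of the kernel,
   for the fixed function [v z'], plus the increment in [(s, a)], for the kernel
   at [z], of the mean of the non-decreasing function [v z' - v z]. *)
have dv_homo : {homo (fun x => v z' x - v z x) : x y / (x <= y)%O >-> x <= y}.
  by move=> x y xy; have := v_diff _ _ _ _ zz' xy; lra.
have := P_mono z dv_homo ss' aa'.
under eq_bigr do rewrite mulrBl.
under [leRHS]eq_bigr do rewrite mulrBl.
rewrite !sumrB /action_value /=.
move=> P1 P2 r1.
have := lerD P1 P2; rewrite -(ler_pM2l (mfg_gamma_gt0 G)).
by lra.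
Qed.

Let q_mono_s v z s s' a : complementary v -> (s <= s')%O -> q v z s a <= q v z s' a.
Proof.
by move=> cv ss'; apply: tremble_mono => // c; exact: h_mono_s.
Qed.

Let q_supermodular v z s s' a a' : complementary v -> (s <= s')%O ->
  q v z s a + q v z s' a' <= q v z s' (Order.join a a') + q v z s (Order.meet a a').
Proof.
move=> cv ss'; have sup b b' := h_supermodular z s s' b b' cv.
rewrite (join_r ss') (meet_l ss') in sup.
apply: tremble_exchange => // b.
by have := sup b b; rewrite joinxx meetxx.
Qed.

Let q_increasing_differences v z z' s s' a a' : complementary v ->
    sd_le z z' -> (s <= s')%O -> (a <= a')%O ->
  q v z' s a + q v z s' a' <= q v z' s' a' + q v z s a.
Proof.
move=> cv zz' ss' aa'.
by apply: tremble_exchange => // [b|]; exact: h_increasing_differences.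
Qed.

(** Bellman optimality operator of the trembling problem; [a0] is only a default
for the choice of a maximizer. *)
Definition bellman v z s : R := q v z s [arg max_(a > a0) q v z s a]%O.

Lemma le_bellman v z s a : q v z s a <= bellman v z s.
Proof. by rewrite /bellman; case: arg_maxP => // i _; apply. Qed.

Lemma bellman_eq v z s : exists a, bellman v z s = q v z s a.
Proof. by exists [arg max_(a > a0) q v z s a]%O. Qed.

Lemma bellman_le v z s c : (forall a, q v z s a <= c) -> bellman v z s <= c.
Proof. by have [a ->] := bellman_eq v z s; apply. Qed.

(** Maximization over a lattice of actions preserves increasing differences. *)
Lemma bellman_complementary v : complementary v -> complementary (bellman v).
Proof.
move=> cv; split=> [z s s' ss'|z z' s s' zz' ss'].
  by apply: bellman_le => a; apply: le_trans (le_bellman _ _ _ a); exact: q_mono_s.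
have [a ->] := bellman_eq v z' s; have [a' ->] := bellman_eq v z s'.
have sup := q_supermodular z' a a' cv ss'.
have diff := q_increasing_differences cv zz' ss' (leIr a' a : Order.meet a a' <= a')%O.
have := le_bellman v z' s' (Order.join a a').
have := le_bellman v z s (Order.meet a a').
by lra.
Qed.

Lemma bellman_mono v v' z s : (forall s, v z s <= v' z s) ->
  bellman v z s <= bellman v' z s.
Proof.
move=> vv'; apply: bellman_le => a; apply: le_trans (le_bellman _ _ _ a).
by apply: tremble_mono => // c; exact: action_value_mono.
Qed.

(** Value iteration, started below every possible return so that the iterates
increase in [n]. *)
Fixpoint value_iterate n : dist R S -> S -> R :=
  if n is m.+1 then bellman (value_iterate m) else fun _ _ => - (1 - mfg_gamma G)^-1.

(* [(1 - gamma)^-1] is the return of the constant reward 1. *)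
Let inv_gap : 1 + mfg_gamma G * (1 - mfg_gamma G)^-1 = (1 - mfg_gamma G)^-1.
Proof. by field; rewrite subr_eq0 gt_eqF // mfg_gamma_lt1. Qed.

Lemma value_iterate_complementary n : complementary (value_iterate n).
Proof.
by elim: n => [|n IH]; [split=> *; rewrite ?lexx|exact: bellman_complementary].
Qed.

Lemma value_iterateS_le n z s : value_iterate n z s <= value_iterate n.+1 z s.
Proof.
elim: n s => [|n IH] s; last exact: bellman_mono.
apply: le_trans (le_bellman _ _ _ a0).
rewrite -[leLHS](tremble_cst eps A_ge2 _ a0).
have hge b : - (1 - mfg_gamma G)^-1 <= h (value_iterate 0) z s b.
  rewrite -[in leLHS]inv_gap /action_value mean_cst opprD mulrN lerD2r.
  by have := mfg_r_bounded G s b z; rewrite ler_norml => /andP[].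
exact: tremble_mono.
Qed.

Lemma value_iterate_le n z s : value_iterate n z s <= (1 - mfg_gamma G)^-1.
Proof.
have gap_gt0 : 0 < (1 - mfg_gamma G)^-1 by rewrite invr_gt0 subr_gt0 mfg_gamma_lt1.
elim: n s => [|n IH] s; first by rewrite /=; lra.
apply: bellman_le => a; rewrite -[leRHS](tremble_cst eps A_ge2 _ a).
have hle b : h (value_iterate n) z s b <= (1 - mfg_gamma G)^-1.
  rewrite -[leRHS]inv_gap; apply: lerD.
    exact: le_trans (ler_norm _) (mfg_r_bounded _ _ _ _).
  by rewrite ler_wpM2l // mean_le.
exact: tremble_mono.
Qed.

(** Limit of value iteration; its Bellman equation is [optimal_value_fixpoint]. *)
Definition optimal_value z s : R := limn (fun n => value_iterate n z s).

Lemma value_iterate_nondecreasing z s :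
  nondecreasing_seq (fun n => value_iterate n z s).
Proof. by apply/nondecreasing_seqP => n; exact: value_iterateS_le. Qed.

Lemma value_iterate_cvg z s : value_iterate n z s @[n --> \oo] --> optimal_value z s.
Proof.
apply: nondecreasing_is_cvgn; first exact: value_iterate_nondecreasing.
by exists (1 - mfg_gamma G)^-1 => _ [n _ <-]; exact: value_iterate_le.
Qed.

Lemma value_iterate_le_optimal n z s : value_iterate n z s <= optimal_value z s.
Proof.
apply: nondecreasing_cvgn_le; first exact: value_iterate_nondecreasing.
exact: cvgP (@value_iterate_cvg z s).
Qed.

Lemma optimal_value_complementary : complementary optimal_value.
Proof.
split=> [z s s' ss'|z z' s s' zz' ss'].
  apply: ler_cvg_to (@value_iterate_cvg z s) (@value_iterate_cvg z s') _.
  by apply: nearW => n; exact: (value_iterate_complementary n).1.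
apply: ler_cvg_to (cvgD (@value_iterate_cvg z' s) (@value_iterate_cvg z s'))
  (cvgD (@value_iterate_cvg z' s') (@value_iterate_cvg z s)) _.
by apply: nearW => n; exact: (value_iterate_complementary n).2.
Qed.

Lemma trembling_value_cvg z s a :
  q (value_iterate n) z s a @[n --> \oo] --> q optimal_value z s a.
Proof.
have hcvg b : h (value_iterate n) z s b @[n --> \oo] --> h optimal_value z s b.
  apply: cvgD; first exact: cvg_cst.
  apply: cvgM; first exact: cvg_cst.
  by apply: cvg_sum => s'; apply: cvgM; [exact: value_iterate_cvg|exact: cvg_cst].
apply: cvgD; apply: cvgM; [exact: cvg_cst|exact: hcvg|exact: cvg_cst|].
exact: cvg_sum.
Qed.

Lemma optimal_value_fixpoint z s : optimal_value z s = bellman optimal_value z s.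
Proof.
apply/eqP; rewrite eq_le; apply/andP; split.
  apply: limr_le; first exact: cvgP (@value_iterate_cvg z s).
  apply: nearW => n; apply: le_trans (value_iterateS_le n z s) _.
  by apply: bellman_mono => s'; exact: value_iterate_le_optimal.
apply: bellman_le => a; rewrite -(cvg_lim _ (@trembling_value_cvg z s a)) //.
apply: limr_le; first exact: cvgP (@trembling_value_cvg z s a).
apply: nearW => n; apply: le_trans (value_iterate_le_optimal n.+1 z s).
exact: le_bellman.
Qed.

(** [a] is an optimal intended action in state [s] at mean field [z]. *)
Definition optimal_action z s a : bool := q optimal_value z s a == optimal_value z s.

Let le_opt z s a : q optimal_value z s a <= optimal_value z s.
Proof. by rewrite [leRHS]optimal_value_fixpoint le_bellman. Qed.

(* Topkis: passing from [a /\ a'] to [a] is worthwhile at [(s, z)], hence at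
   [(s, z')], and so passing from [a'] to [a \/ a'] is worthwhile at [(s', z')]. *)
Let opt_join z z' s s' a a' : sd_le z z' -> (s <= s')%O ->
    optimal_action z s a -> optimal_action z' s' a' ->
  optimal_action z' s' (Order.join a a').
Proof.
move=> zz' ss' /eqP aE /eqP a'E; rewrite /optimal_action eq_le le_opt /= -a'E.
have cv := optimal_value_complementary.
have sup := q_supermodular z' a a' cv ss'.
have diff := q_increasing_differences cv zz' (lexx s)
  (leIl a a' : Order.meet a a' <= a)%O.
have := le_opt z s (Order.meet a a'); rewrite -aE.
by move: sup diff; lra.
Qed.

Definition some_optimal_action z s : A := [arg max_(a > a0) q optimal_value z s a]%O.

Let some_optimal_actionP z s : optimal_action z s (some_optimal_action z s).
Proof. by rewrite /optimal_action [X in _ == X]optimal_value_fixpoint. Qed.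

(** Join of all optimal actions; folding from an optimal one avoids the need for
a bottom element. *)
Definition largest_reply z s : A :=
  \big[Order.join/some_optimal_action z s]_(a <- enum A | optimal_action z s a) a.

Lemma largest_reply_opt z s :
  q optimal_value z s (largest_reply z s) = optimal_value z s.
Proof.
apply/eqP; apply: (big_ind (optimal_action z s)) => // a a'.
by apply: opt_join => //; exact: sd_le_refl.
Qed.

Lemma largest_reply_mono z z' s s' : sd_le z z' -> (s <= s')%O ->
  (largest_reply z s <= largest_reply z' s')%O.
Proof.
move=> zz' ss'; apply: le_trans (leUl _ (largest_reply z' s')) _.
apply: bigjoin_ge; first by rewrite mem_enum.
by apply: opt_join zz' ss' _ _; apply/eqP; exact: largest_reply_opt.
Qed.

(** Trembling-hand strategy intending the largest optimal action. *)
Definition largest_strategy z : strategy R S A :=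
  fun s => tremble_dist A_ge2 eps_gt0 eps_small (largest_reply z s).

Lemma policy_operator_largest z s :
  policy_operator G (largest_strategy z) z (optimal_value z) s = optimal_value z s.
Proof. by rewrite /policy_operator tremble_dist_mean; exact: largest_reply_opt. Qed.

Lemma largest_strategy_best_response z : best_response G eps z (largest_strategy z).
Proof.
split; first exact: trembling_tremble_dist.
move=> nu nu_trembling s; apply: (@le_trans _ _ (optimal_value z s)).
  apply: (@policy_comparison _ _ _ G nu z (value G nu z)) => {}s.
    by rewrite -value_fixpoint.
  have [a [nua nub]] := nu_trembling s.
  by rewrite /policy_operator (tremble_mean _ nua nub); exact: le_opt.
apply: (@policy_comparison _ _ _ G (largest_strategy z) z) => {}s.
  by rewrite policy_operator_largest.
by rewrite -value_fixpoint.
Qed.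

Lemma mckean_vlasov_largest_mono z z' : sd_le z z' ->
  sd_le (mckean_vlasov G z (largest_strategy z))
        (mckean_vlasov G z' (largest_strategy z')).
Proof.
move=> zz' f f_homo.
pose e z s a := \sum_x f x * mfg_P G s a z x.
have mvE w : \sum_x f x * mckean_vlasov G w (largest_strategy w) x =
    \sum_s tremble eps (e w s) (largest_reply w s) * w s.
  under eq_bigr do rewrite ffunE mulr_sumr.
  rewrite exchange_big; apply: eq_bigr => s _ /=.
  under eq_bigr do rewrite mulr_sumr.
  rewrite exchange_big -tremble_dist_mean mulr_suml; apply: eq_bigr => a _ /=.
  rewrite /e mulr_sumr mulr_suml; apply: eq_bigr => x _.
  by rewrite /largest_strategy; ring.
rewrite !mvE.
have e_mono w s s' b b' : (s <= s')%O -> (b <= b')%O -> e w s b <= e w s' b'.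
  by move=> ss' bb'; exact: P_mono.
have ez s b : e z s b <= e z' s b by exact: (sc_P_nondecreasing_z sc).
(* Replace [z] by [z'] first as the law of the state, then in the kernel and in
   the strategy. *)
apply: (@le_trans _ _ (\sum_s tremble eps (e z s) (largest_reply z s) * z' s)).
  apply: zz' => s s' ss'; apply: tremble_mono => // [c|]; apply: e_mono => //.
  by apply: largest_reply_mono => //; exact: sd_le_refl.
apply: mean_le_mean => s; apply: tremble_mono => //.
by apply: e_mono => //; exact: largest_reply_mono.
Qed.

End Complementarities.

Theorem theorem1 (R : realType) (dS dA : Order.disp_t)
    (S : finLatticeType dS) (A : finLatticeType dA)
    (S_gt0 : (0 < #|S|)%N) (A_ge2 : (2 <= #|A|)%N)
    (G : mfg R S A) (eps : R)
    (eps_gt0 : 0 < eps) (eps_lt1 : eps < 1)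
    (eps_small : eps / (#|A|%:R - 1) < 1 - eps) :
  strategic_complementarities G ->
  exists (mu : strategy R S A) (z : dist R S), is_TMFE G eps mu z.
Proof.
move=> sc.
have /card_gt0P[s0 _] := S_gt0.
have /card_gt0P[a0 _] : (0 < #|A|)%N by exact: ltnW.
have [bot bot_le] := finlattice_bottom s0.
pose mu := @largest_strategy R dS dA S A G eps A_ge2 eps_gt0 eps_small a0.
have [z zE] := @sd_fixpoint R dS S bot (fun z => mckean_vlasov G z (mu z)) bot_le
  (mckean_vlasov_largest_mono A_ge2 eps_gt0 eps_small sc a0).
exists (mu z), z; split => //; first exact: trembling_tremble_dist.
exact: largest_strategy_best_response.
Qed.
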